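(* If $\mathfrak{n}$ is a nilpotent $\mathbb{F}_q$-algebra, then the product of any two supernormal subgroups of $U_\mathfrak{n}$ is a supernormal subgroup of $U_\mathfrak{n}$.
   Context: $\mathbb{F}_q$ is a finite field; all $\mathbb{F}_q$-algebras are finite-dimensional and associative. For a nilpotent $\mathbb{F}_q$-algebra $\mathfrak{n}$, the algebra group is $U_\mathfrak{n}=\{1+X:X\in\mathfrak{n}\}$ with multiplication $(1+X)(1+Y)=1+X+Y+XY$. It acts on $\mathfrak{n}$ by $(1+X)Y=Y+XY$ and $Y(1+X)=Y+YX$. The superclass of $U_\mathfrak{n}$ containing $g$ is $\{1+x(g-1)y:x,y\in U_\mathfrak{n}\}$. A subgroup of $U_\mathfrak{n}$ is supernormal if it is a union of superclasses of $U_\mathfrak{n}$ (it is not assumed to come from an $\mathbb{F}_q$-subalgebra). The product of subgroups $H,H'$ is $HH'=\{hh':h\in H,h'\in H'\}$. *)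

(* Defs.v *)
From HB Require Import structures.
From mathcomp Require Import all_boot all_order all_algebra all_fingroup all_field.

Set Implicit Arguments.
Unset Strict Implicit.
Unset Printing Implicit Defensive.

Import GRing.Theory.

Local Open Scope ring_scope.

(* MathComp's algebras are unital, so possibly non-unital finite-dimensional  *)
(* associative algebras are built here on top of vectType.                    *)
HB.mixin Record Vector_isAssocAlg (F : fieldType) N of Vector F N := {
  nmul : N -> N -> N;
  nmulA : associative nmul;
  nmul_linearl : forall y : N, linear (nmul^~ y);
  nmul_linearr : forall x : N, linear (nmul x)
}.

#[short(type="assocAlgType")]
HB.structure Definition AssocAlg (F : fieldType) :=
  {N of Vector_isAssocAlg F N & Vector F N}.

(* N^(k+1) = 0: every product x s_1 ... s_k of k+1 elements vanishes.         *)
HB.mixin Record AssocAlg_isNilpotent (F : fieldType) N of AssocAlg F N := {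
  nmul_nilpotent : exists k : nat,
    forall (x : N) (s : seq N), size s = k -> foldl nmul x s = 0
}.

#[short(type="nilpAlgType")]
HB.structure Definition NilpAlg (F : fieldType) :=
  {N of AssocAlg_isNilpotent F N & AssocAlg F N}.

Local Notation "x ** y" := (nmul x y) (at level 40, left associativity).

Section NmulTheory.

Variables (F : fieldType) (N : assocAlgType F).
Implicit Types x y z : N.

Lemma nmulDl x y z : (x + y) ** z = x ** z + y ** z.
Proof. by have := nmul_linearl z 1 x y; rewrite !scale1r. Qed.

Lemma nmulDr x y z : x ** (y + z) = x ** y + x ** z.
Proof. by have := nmul_linearr x 1 y z; rewrite !scale1r. Qed.

Lemma nmul0r x : 0 ** x = 0.
Proof. by apply: (addrI (0 ** x)); rewrite -nmulDl !addr0. Qed.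

Lemma nmulr0 x : x ** 0 = 0.
Proof. by apply: (addrI (x ** 0)); rewrite -nmulDr !addr0. Qed.

Lemma nmulrN x y : x ** (- y) = - (x ** y).
Proof. by apply/eqP; rewrite -addr_eq0 -nmulDr addNr nmulr0. Qed.

Lemma nmulNr x y : (- x) ** y = - (x ** y).
Proof. by apply/eqP; rewrite -addr_eq0 -nmulDl addNr nmul0r. Qed.

End NmulTheory.

(* AlgGroup X stands for the element 1 + X of the algebra group U_N, and      *)
(* aug g for g - 1.                                                           *)
Record algGroup (F : finFieldType) (N : nilpAlgType F) : predArgType :=
  AlgGroup { aug : N }.

Section AlgGroupTheory.

Variables (F : finFieldType) (N : nilpAlgType F).
Local Notation U := (algGroup N).
Implicit Types (g h x y : U) (X Y Z : N).

(* A finite-dimensional space over a finite field carries its finType         *)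
(* structure on the alias finvect_type.                                       *)
Definition aug_fin (g : U) : finvect_type N := aug g.
Definition AlgGroup_fin (X : finvect_type N) : U := AlgGroup X.

Lemma aug_finK : cancel aug_fin AlgGroup_fin.
Proof. by case. Qed.

HB.instance Definition _ := Countable.copy U (can_type aug_finK).
HB.instance Definition _ := isFinite.Build U (pcan_enumP (can_pcan aug_finK)).

Definition ag_one : U := AlgGroup 0.
Definition ag_mul g h : U := AlgGroup (aug g + aug h + aug g ** aug h).

(* Picks a left inverse of g; one always exists, by nilpotency (ag_mulV).     *)
Definition ag_inv g : U := odflt ag_one [pick h | ag_mul h g == ag_one].

Lemma ag_mulA : associative ag_mul.
Proof.
move=> [X] [Y] [Z]; congr AlgGroup => /=.
rewrite !(nmulDl, nmulDr) nmulA -!addrA.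
congr (X + (Y + _)); rewrite [RHS]addrCA; congr (Z + _).
by rewrite (addrCA (X ** Z)) [RHS]addrCA.
Qed.

Lemma ag_mul1 : left_id ag_one ag_mul.
Proof. by case=> X; rewrite /ag_mul /= nmul0r addr0 add0r. Qed.

Lemma nmul_fix0 X Z : Z ** X = Z -> Z = 0.
Proof.
move=> ZX; have [k nilk] := @nmul_nilpotent F N.
have <- : foldl nmul Z (nseq k X) = Z; last by rewrite nilk ?size_nseq.
by elim: k {nilk} => //= k; rewrite ZX.
Qed.

Lemma ag_mulIg h : injective (ag_mul^~ h).
Proof.
case: h => Y [X1] [X2] [] /=; rewrite !(addrAC _ Y) => /addIr E.
congr AlgGroup; apply/eqP; rewrite -subr_eq0; apply/eqP.
apply: (@nmul_fix0 (- Y)); rewrite nmulrN nmulDl nmulNr opprB.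
by apply/eqP; rewrite subr_eq addrAC eq_sym subr_eq E addrC.
Qed.

Lemma ag_mulV : left_inverse ag_one ag_inv ag_mul.
Proof.
move=> g; rewrite /ag_inv; case: pickP => [h /eqP //| /= no_inv].
have := no_inv (invF (@ag_mulIg g) ag_one).
by rewrite (f_invF (@ag_mulIg g)) eqxx.
Qed.

HB.instance Definition _ := Finite_isGroup.Build U ag_mulA ag_mul1 ag_mulV.

Definition lact x Y : N := Y + aug x ** Y.
Definition ract Y y : N := Y + Y ** aug y.

(* { 1 + x(g-1)y : x, y in U_N }.                                             *)
Definition superclass g : {set U} :=
  [set AlgGroup (ract (lact x (aug g)) y) | x : U, y : U].

Definition supernormal (A : {set U}) : Prop :=
  exists S : {set U}, A = \bigcup_(g in S) superclass g.

End AlgGroupTheory.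

(* Main.v *)
Require Import Defs.
From mathcomp Require Import all_boot all_order all_algebra all_fingroup all_field.

Import GRing.Theory.

(** Write $U$ for the algebra group, whose elements are the $1 + X$.  The left
    and right translations of the algebra by $U$ are commuting actions, so a
    supernormal set is exactly a set of elements $1 + X$ stable under every
    $1 + X \mapsto 1 + xXy$ ([supernormalP]).

    Conjugation by $g$ sends $1 + X$ to $1 + g^{-1}Xg$, hence supernormal
    subgroups are normal and $HH'$ is a subgroup.

    For supernormality, take $h = 1 + X \in H$ and $h' = 1 + Y \in H'$.  Since
    $hh' - 1 = X + hY$,
    $$1 + x(hh' - 1)y = 1 + X' + Y', \quad X' = xXy, \quad Y' = (xh)Yy,$$
    where $k = 1 + X'$ lies in $H$ and $1 + Y'$ in $H'$.  This is a product
    again, because $1 + X' + Y' = k(1 + k^{-1}Y')$ ([algGroup_addE]), and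
    $1 + k^{-1}Y'$ still lies in $H'$.  *)

Section AlgGroupTranslations.

Local Open Scope ring_scope.

Variables (F : finFieldType) (n : nilpAlgType F).
(* The name ract also belongs to the restriction of group actions. *)
Local Notation ract := Defs.ract.
Local Notation U := (algGroup n).
Implicit Types (g h x y : U) (X Y : n) (A B : {set U}).

Lemma lactD x X Y : lact x (X + Y) = lact x X + lact x Y.
Proof. by rewrite /lact nmulDr addrACA. Qed.

Lemma ractD X Y y : ract (X + Y) y = ract X y + ract Y y.
Proof. by rewrite /ract nmulDl addrACA. Qed.

Lemma lact1 X : lact 1%g X = X.
Proof. by rewrite /lact nmul0r addr0. Qed.

Lemma ract1 X : ract X 1%g = X.
Proof. by rewrite /ract nmulr0 addr0. Qed.

Lemma aug_mull g h : aug (g * h)%g = aug g + lact g (aug h).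
Proof. by rewrite /lact addrA. Qed.

Lemma aug_mulr g h : aug (g * h)%g = aug h + ract (aug g) h.
Proof. by rewrite /ract addrA (addrC (aug h)). Qed.

Lemma lactM x y X : lact (x * y)%g X = lact x (lact y X).
Proof. by rewrite lactD /lact aug_mull /lact !nmulDl nmulA !addrA (addrAC X). Qed.

Lemma ractM X x y : ract X (x * y)%g = ract (ract X x) y.
Proof. by rewrite ractD /ract aug_mulr /ract !nmulDr -nmulA !addrA. Qed.

Lemma lact_ract x X y : lact x (ract X y) = ract (lact x X) y.
Proof. by rewrite lactD ractD /lact /ract nmulA addrACA. Qed.

(** Conjugation is an instance of the two-sided translation action, which is
    why supernormal sets are normalised by the whole group. *)
Lemma aug_conjg h g : aug (h ^ g)%g = ract (lact g^-1%g (aug h)) g.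
Proof.
rewrite conjgE aug_mull aug_mulr lactD addrA -aug_mull mulVg add0r.
exact: lact_ract.
Qed.

(** Superclasses are the orbits of the two-sided translation action, so being
    a union of superclasses amounts to being stable under that action. *)
Lemma supernormalP A :
  supernormal A <->
  (forall g x y, g \in A -> AlgGroup (ract (lact x (aug g)) y) \in A).
Proof.
split=> [[S ->] g x y /bigcupP[s sS /imset2P[a b _ _ ->]] | stableA].
  apply/bigcupP; exists s => //; apply/imset2P.
  by exists (x * a)%g (b * y)%g => //; rewrite lactM ractM lact_ract.
exists A; apply/setP=> g; apply/idP/bigcupP=> [gA | [s sA /imset2P[x y _ _ ->]]].
  by exists g => //; apply/imset2P; exists 1%g 1%g; rewrite // lact1 ract1; case: g {gA}.
exact: stableA.
Qed.

Lemma supernormal_norm A B : supernormal A -> (B \subset 'N(A))%g.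
Proof.
move=> /supernormalP stableA; apply/subsetP=> g _; rewrite inE.
apply/subsetP=> _ /imsetP[h hA ->].
rewrite (_ : h ^ g = AlgGroup (ract (lact g^-1 (aug h)) g))%g ?stableA //.
by rewrite -aug_conjg; case: (h ^ g)%g.
Qed.

(** Adding $X$ to $g$ amounts to multiplying $g$ on the right:
    $g + X = g(1 + g^{-1}X)$. *)
Lemma algGroup_addE g X : AlgGroup (aug g + X) = (g * AlgGroup (lact g^-1 X))%g.
Proof.
by rewrite -{1}[X]lact1 -(mulgV g) lactM -[lact g^-1%g X]/(aug (AlgGroup _)) -aug_mull.
Qed.

Lemma supernormal_mul A B : supernormal A -> supernormal B -> supernormal (A * B)%g.
Proof.
move=> /supernormalP stableA /supernormalP stableB; apply/supernormalP.
move=> _ x y /mulsgP[h k hA kB ->].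
rewrite aug_mull lactD ractD -lactM.
(* Here 1 + X is the k of the factorisation k(1 + k^-1 Y') above. *)
set X := ract _ y.
rewrite -[X]/(aug (AlgGroup X)) algGroup_addE lact_ract -lactM.
by apply: mem_mulg; [apply: stableA | apply: stableB].
Qed.

End AlgGroupTranslations.

Theorem corollary3p1 (F : finFieldType) (n : nilpAlgType F)
    (H H' : {group algGroup n}) :
  supernormal H -> supernormal H' ->
  group_set (H * H')%g /\ supernormal (H * H')%g.
Proof.
move=> snH snH'; split; last exact: supernormal_mul.
by apply/comm_group_setP/normC/supernormal_norm.
Qed.
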